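(* Let $(x^k)_{k\in\mathbb{N}}$ be the sequence generated by either the absolute-error method or the relative-error method (both defined in the context), with constant stepsizes $\alpha_k=\alpha$ for all $k$, where $\alpha>0$, and with $\lim_{k\to\infty}\epsilon_k=\epsilon$ for some $\epsilon\in[0,\infty)$. Assume there exists $c>0$ such that for every $k\in\mathbb{N}$ one has $\max\{\|\overline{w}^k\|,\|w^k\|,\|u^k\|\}\le c$ for some $w^k\in\partial g(x^k)$. Then the following hold. (i) If $s^\star=-\infty$, then $\liminf_{k\to\infty}(f+g)(x^k)=s^\star$ (for either method). (ii) If $s^\star>-\infty$ and $(x^k)$ is generated by the absolute-error method, then $$\liminf_{k\to\infty}(f+g)(x^k)\le s^\star+\epsilon+2\alpha c^2.$$ (iii) If $s^\star>-\infty$ and $(x^k)$ is generated by the relative-error method with parameter $\sigma$, then $$\liminf_{k\to\infty}(f+g)(x^k)\le s^\star+\epsilon+\frac{\alpha C_\sigma c^2}{2},\qquad C_\sigma=\frac{\sigma^2}{(1-\sigma)^2}+4.$$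
   Context: $\mathbb{H}$ is a real Hilbert space; $f,g:\mathbb{H}\to\,]-\infty,\infty]$ are convex functions with domains $\mathrm{dom}\,f=\{x: f(x)<\infty\}$ and $\mathrm{dom}\,g$ (defined likewise); $C\subseteq\mathbb{H}$ is nonempty, closed and convex; $\mathrm{dom}\,g\subseteq\mathrm{dom}\,f$ and $C\subseteq\mathrm{int}(\mathrm{dom}\,g)$. $s^\star:=\inf_{x\in C}(f+g)(x)$. $P_C$ is the orthogonal projection onto $C$. For $\epsilon\ge0$ and a convex function $h$, $\partial_\epsilon h(x)=\{v: h(x')\ge h(x)+\langle v,x'-x\rangle-\epsilon\ \ \forall x'\in\mathbb{H}\}$ and $\partial h=\partial_0h$. Absolute-error method: given $x^0\in C$, $(r_k)\subset[0,\infty)$ with $\sum_k r_k^2<\infty$, $(\alpha_k)\subset(0,\infty)$, $(\epsilon_k)\subset[0,\infty)$, for $k=0,1,\dots$: (1) $y^k=x^k-\alpha_ku^k$ with $u^k\in\partial_{\epsilon_k}f(x^k)$; (2) compute $\overline{x}^k,\overline{w}^k$ with $\overline{w}^k\in\partial g(\overline{x}^k)$ and $\|\alpha_k\overline{w}^k+\overline{x}^k-y^k\|\le r_k$; (3) $x^{k+1}=P_C(y^k-\alpha_k\overline{w}^k)$. Relative-error method: given $\sigma\in[0,1)$, $x^0\in C$, $(\alpha_k)\subset(0,\infty)$, $(\epsilon_k)\subset[0,\infty)$, for $k=0,1,\dots$: (1) $y^k=x^k-\alpha_ku^k$ with $u^k\in\partial_{\epsilon_k}f(x^k)$; (2) compute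 $(\overline{x}^k,\overline{w}^k,\overline{\epsilon}_k)\in\mathbb{H}\times\mathbb{H}\times[0,\infty)$ with $\overline{w}^k\in\partial_{\overline{\epsilon}_k}g(\overline{x}^k)$ and $\|\alpha_k\overline{w}^k+\overline{x}^k-y^k\|^2+2\alpha_k\overline{\epsilon}_k\le\sigma^2\|\overline{x}^k-y^k\|^2$; (3) $x^{k+1}=P_C(y^k-\alpha_k\overline{w}^k)$. *)

(* Defs.v *)
From HB Require Import structures.
From mathcomp Require Import all_boot all_order all_algebra sesquilinear.
From mathcomp Require Import all_classical all_reals all_analysis.

Set Implicit Arguments.
Unset Strict Implicit.
Unset Printing Implicit Defensive.

Import Order.TTheory GRing.Theory Num.Theory.
Import numFieldNormedType.Exports.

Local Open Scope classical_set_scope.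
Local Open Scope ring_scope.

(* A real Hilbert space is a complete normed module H together with a positive
   definite symmetric bilinear form that induces the norm of H. *)
Definition dot_induces_norm (R : realType) (H : completeNormedModType R)
    (dot : {dot H for idfun}) : Prop :=
  forall x : H, `|x| = Num.sqrt (dot x x).

Section convex_analysis.
Context {R : realType} {H : completeNormedModType R}.
Variable dot : {dot H for idfun}.
Implicit Types (h : H -> \bar R) (C : set H).

Definition effective_domain h : set H := [set x | (h x < +oo)%E].

(* Convex functions with values in ]-oo, +oo]; the value -oo is excluded, so
   the sums below are never of the form -oo + +oo. *)
Definition convex_efunction h : Prop :=
  (forall x, (-oo < h x)%E) /\
  (forall (x y : H) (t : R), 0 <= t <= 1 ->
    (h (t *: x + (1 - t) *: y)%R
       <= t%:E * h x + (1 - t)%R%:E * h y)%E).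

Definition eps_subdifferential h (e : R) (x : H) : set H :=
  [set v | forall x' : H, (h x + (dot v (x' - x) - e)%R%:E <= h x')%E].

Definition subdifferential h (x : H) : set H := eps_subdifferential h 0 x.

(* The nearest point of C to z (z itself if there is none, which does not occur
   for C nonempty, closed and convex). *)
Definition orthogonal_projection C (z : H) : H :=
  xget z [set p | C p /\ forall q, C q -> `|z - p| <= `|z - q|].

Record absolute_error_method (f g : H -> \bar R) C
    (r_ alpha_ eps_ : nat -> R) (x y u xbar wbar : nat -> H) : Prop := {
  abs_x0 : C (x 0%N) ;
  abs_r_ge0 : forall k, 0 <= r_ k ;
  abs_r_summable : cvgn (series (fun k => r_ k ^+ 2)) ;
  abs_alpha_gt0 : forall k, 0 < alpha_ k ;
  abs_eps_ge0 : forall k, 0 <= eps_ k ;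
  abs_u : forall k, eps_subdifferential f (eps_ k) (x k) (u k) ;
  abs_y : forall k, y k = x k - alpha_ k *: u k ;
  abs_wbar : forall k, subdifferential g (xbar k) (wbar k) ;
  abs_error : forall k, `|alpha_ k *: wbar k + xbar k - y k| <= r_ k ;
  abs_x : forall k,
    x k.+1 = orthogonal_projection C (y k - alpha_ k *: wbar k)
}.

Record relative_error_method (f g : H -> \bar R) C
    (sigma : R) (alpha_ eps_ epsbar : nat -> R)
    (x y u xbar wbar : nat -> H) : Prop := {
  rel_sigma : 0 <= sigma < 1 ;
  rel_x0 : C (x 0%N) ;
  rel_alpha_gt0 : forall k, 0 < alpha_ k ;
  rel_eps_ge0 : forall k, 0 <= eps_ k ;
  rel_u : forall k, eps_subdifferential f (eps_ k) (x k) (u k) ;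
  rel_y : forall k, y k = x k - alpha_ k *: u k ;
  rel_epsbar_ge0 : forall k, 0 <= epsbar k ;
  rel_wbar : forall k, eps_subdifferential g (epsbar k) (xbar k) (wbar k) ;
  rel_error : forall k,
    `|alpha_ k *: wbar k + xbar k - y k| ^+ 2 + 2 * alpha_ k * epsbar k
      <= sigma ^+ 2 * `|xbar k - y k| ^+ 2 ;
  rel_x : forall k,
    x k.+1 = orthogonal_projection C (y k - alpha_ k *: wbar k)
}.

End convex_analysis.

(* Main.v *)
Require Import Defs.
From HB Require Import structures.
From mathcomp Require Import all_boot all_order all_algebra sesquilinear.
From mathcomp Require Import all_classical all_reals all_analysis.
From mathcomp Require Import ring lra.
Import Order.TTheory GRing.Theory Num.Theory.
Import numFieldNormedType.Exports.
Local Open Scope classical_set_scope.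
Local Open Scope ring_scope.

(** Everything rests on one inequality for a single step.  Let e be the residual
    alpha wbar + xbar - y of the inexact resolvent, let ebar be the error of the
    subgradient wbar (zero in the absolute-error method), and write F = f + g.
    Projecting onto C does not increase the distance to a point z of C, so
    |x+ - z|^2 is at most |x - alpha (u + wbar) - z|^2.  Expanding this square,
    bounding the inner product by the inequalities of the approximate
    subgradients u and wbar, and comparing g(xbar) with g(x) through w in the
    subdifferential of g at x, one gets

      |x+ - z|^2 <= |x - z|^2 - 2 alpha (F x - F z - eps_k)
                    + 2 alpha ebar
                    + 2 alpha <wbar - w, xbar - x> + alpha^2 |u + wbar|^2.

    The last line equals |e|^2 + alpha^2 |u + w|^2 - |e - alpha (wbar - w)|^2
    (backward_error_identity), hence is at most |e|^2 + 4 alpha^2 c^2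
    (forward_backward_descent).

    The two methods differ only in the bound on |e|^2 + 2 alpha ebar: it is at
    most r_k^2, which tends to 0, or at most
    alpha^2 c^2 sigma^2 / (1 - sigma)^2 (relative_error_le).

    If F(x_k) stayed above F z + eps + D, where D collects the constant terms
    divided by 2 alpha, by a fixed margin, then |x_k - z|^2 would eventually
    decrease by a fixed amount at each step, which is absurd
    (limn_einf_le_of_descent).  So the lower limit of F(x_k) is at most
    F z + eps + D for every z in C, hence at most sstar + eps + D.  This covers
    sstar = -oo as well, the right-hand side then being -oo.

    The projection P_C(v) exists because, by the parallelogram identity, a
    sequence minimizing the squared distance from v to C is Cauchy. *)

(** * Inner product and projection onto a closed convex set *)

Section hilbert.
Set Implicit Arguments.
Unset Strict Implicit.
Context (R : realType) (H : completeNormedModType R).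
Context (dot : {dot H for idfun}) (Hdot : dot_induces_norm dot).
Implicit Types (a b p q v z : H) (C : set H) (t : R).

Lemma dotC a b : dot a b = dot b a.
Proof. by rewrite hermC/= expr0 mul1r. Qed.

Lemma sqr_norm_dot a : `|a| ^+ 2 = dot a a.
Proof.
rewrite Hdot sqr_sqrtr//.
by have [->|/neq0_dnorm_gt0/ltW//] := eqVneq a 0; rewrite linear0r.
Qed.

Lemma sqr_normB a b : `|a - b| ^+ 2 = `|a| ^+ 2 - 2 * dot a b + `|b| ^+ 2.
Proof.
rewrite !sqr_norm_dot linearBl !linearBr /= (dotC b a).
by ring.
Qed.

Lemma sqr_normBZ t a b :
  `|a - t *: b| ^+ 2 = `|a| ^+ 2 - 2 * t * dot a b + t ^+ 2 * `|b| ^+ 2.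
Proof.
rewrite sqr_normB linearZr_LR /= normrZ exprMn real_normK ?num_real//.
by ring.
Qed.

Lemma convex_set_segment C p q t :
  convex_set C -> C p -> C q -> 0 <= t <= 1 -> C (t *: p + (1 - t) *: q).
Proof.
move=> Cc Cp Cq /andP[t0 t1].
exact: (set_mem (Cc p q (Itv01 t0 t1) (mem_set Cp) (mem_set Cq))).
Qed.

(** The parallelogram identity, with the midpoint of p and q at squared distance
    at least d2 from v: two nearly optimal points of C are close together. *)
Lemma midpoint_sqr_dist C v p q (d2 : R) :
  convex_set C -> C p -> C q -> (forall m, C m -> d2 <= `|v - m| ^+ 2) ->
  `|p - q| ^+ 2 <= 2 * (`|v - p| ^+ 2 - d2) + 2 * (`|v - q| ^+ 2 - d2).
Proof.
move=> Cc Cp Cq d2le.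
have h2 : 0 <= (2^-1 : R) <= 1 by lra.
have := d2le _ (convex_set_segment Cc Cp Cq h2).
have -> : v - (2^-1 *: p + (1 - 2^-1) *: q) = (v - p) - 2^-1 *: (q - p).
  rewrite (_ : 1 - 2^-1 = 2^-1 :> R); last by lra.
  rewrite scalerBr opprB -!addrA; congr (_ + _).
  rewrite opprD [RHS]addrA; congr (_ - _).
  by rewrite -[X in - X + _]scale1r -!scaleNr -scalerDl; congr (_ *: _); lra.
have -> : `|v - q| ^+ 2 = `|(v - p) - (q - p)| ^+ 2.
  by rewrite opprB addrA subrK.
have -> : `|p - q| = `|q - p| by rewrite distrC.
rewrite sqr_normBZ (sqr_normB (v - p)) => ?.
by lra.
Qed.

Lemma nearest_point_exists C v : C !=set0 -> closed C -> convex_set C ->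
  exists p, C p /\ forall q, C q -> `|v - p| <= `|v - q|.
Proof.
move=> [q0 Cq0] Cl Cc.
pose D := [set `|v - q| ^+ 2 | q in C].
have infD : has_inf D.
  by split; [exists (`|v - q0| ^+ 2), q0|exists 0 => _ [q _ <-]].
set d2 := inf D.
have d2le m : C m -> d2 <= `|v - m| ^+ 2.
  by move=> Cm; apply: ge_inf; [case: infD|exists m].
have minseq n : exists m, C m /\ `|v - m| ^+ 2 < d2 + n.+1%:R^-1.
  have n0 : 0 < n.+1%:R^-1 :> R by rewrite invr_gt0.
  by have [_ [m Cm <-] lt] := inf_adherent n0 infD; exists m.
have [pn /all_and2[Cpn pn_lt]] := choice minseq.
have cpn : cvgn pn.
  apply/cauchy_cvgP/cauchy_exP => e e0.
  have e20 : 0 < e ^+ 2 / 4 by rewrite divr_gt0// exprn_gt0.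
  have [N _ HN] := near_infty_natSinv_lt (PosNum e20).
  exists (pn N); exists N => // m /= Nm.
  rewrite -ball_normE /= -(ltr_pXn2r (n := 2)) ?nnegrE// 1?ltW//.
  apply: le_lt_trans (midpoint_sqr_dist Cc (Cpn N) (Cpn m) d2le) _.
  have hm : m.+1%:R^-1 < e ^+ 2 / 4 := HN _ Nm.
  have hN : N.+1%:R^-1 < e ^+ 2 / 4 := HN _ (leqnn N).
  move: (pn_lt N) (pn_lt m) hm hN.
  by move: N.+1%:R^-1 m.+1%:R^-1 => rN rm; lra.
pose p := limn pn.
have Cp : C p by apply: (closed_cvg C) cpn => //; exact: nearW.
exists p; split => // q Cq.
rewrite -(ler_pXn2r (n := 2)) ?nnegrE//; apply: le_trans (d2le q Cq).
have distp : (fun n => `|v - pn n| ^+ 2) @ \oo --> `|v - p| ^+ 2.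
  by apply: cvgM; apply: cvg_norm; apply: cvgB => //; exact: cvg_cst.
have d2p : (fun n => d2 + n.+1%:R^-1) @ \oo --> d2 + 0.
  by apply: cvgD; [exact: cvg_cst|exact: cvg_harmonic].
rewrite -[leRHS]addr0; apply: ler_cvg_to distp d2p _.
by apply: nearW => n; rewrite ltW.
Qed.

Lemma orthogonal_projectionP C v : C !=set0 -> closed C -> convex_set C ->
  C (orthogonal_projection C v) /\
  forall q, C q -> `|v - orthogonal_projection C v| <= `|v - q|.
Proof.
move=> C0 Cl Cc; have [p hp] := nearest_point_exists v C0 Cl Cc.
pose P := [set p | C p /\ forall q, C q -> `|v - p| <= `|v - q|].
exact: (xgetPex v (P := P) (ex_intro _ p hp)).
Qed.

(** Otherwise moving from p towards z would decrease the distance to v: the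
    squared distance at parameter t is |v - p|^2 - 2 t a + t^2 b, where a is the
    inner product and b = |z - p|^2. *)
Lemma orthogonal_projection_obtuse C v z (p := orthogonal_projection C v) :
  C !=set0 -> closed C -> convex_set C -> C z -> dot (v - p) (z - p) <= 0.
Proof.
move=> C0 Cl Cc Cz; have [Cp pmin] := orthogonal_projectionP v C0 Cl Cc.
rewrite -/p in Cp pmin; rewrite leNgt; apply/negP => a0.
set a := dot _ _ in a0; set b := `|z - p| ^+ 2.
have b0 : 0 <= b by rewrite exprn_ge0.
(* Any t in ]0, 1] with t * b < 2 * a would do; this one avoids dividing by b,
   which could vanish, and never exceeds 1. *)
pose t := a / (a + b).
have ab0 : 0 < a + b by lra.
have t0 : 0 < t by rewrite divr_gt0.
have t1 : t <= 1 by rewrite ler_pdivrMr// mul1r; lra.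
have t01 : 0 <= t <= 1 by rewrite ltW.
have := pmin _ (convex_set_segment Cc Cz Cp t01).
have -> : v - (t *: z + (1 - t) *: p) = (v - p) - t *: (z - p).
  by rewrite scalerBl scale1r scalerBr addrCA opprD addrA.
rewrite -(ler_pXn2r (n := 2)) ?nnegrE// sqr_normBZ -/a -/b.
have tab : t * (a + b) = a by rewrite divfK// gt_eqF.
have -> : t ^+ 2 * b = t * (t * (a + b) - t * a) by ring.
rewrite tab => h.
have ta0 : 0 < t * a by rewrite mulr_gt0.
have : 0 < t * (t * a) by rewrite mulr_gt0.
by lra.
Qed.

Lemma orthogonal_projection_contract C v z :
  C !=set0 -> closed C -> convex_set C -> C z ->
  `|orthogonal_projection C v - z| ^+ 2 <= `|v - z| ^+ 2.
Proof.
move=> C0 Cl Cc Cz; have := orthogonal_projection_obtuse v C0 Cl Cc Cz.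
set p := orthogonal_projection C v => obt.
have -> : `|v - z| ^+ 2 = `|(v - p) - (z - p)| ^+ 2.
  by rewrite opprB addrA subrK.
have := exprn_ge0 2 (normr_ge0 (v - p)).
by rewrite (sqr_normB (v - p)) (distrC p z); lra.
Qed.

(** * One step of the methods *)

(** With e the residual, xbar - x = e - t (u + wbar); both sides are then
    quadratic forms in e, u + wbar and wbar - w.  The subtracted square is what
    keeps |wbar - w| out of the final bound. *)
Lemma backward_error_identity t (u w wbar x xbar y : H) :
  y = x - t *: u ->
  2 * t * dot (wbar - w) (xbar - x) + t ^+ 2 * `|u + wbar| ^+ 2 =
  `|t *: wbar + xbar - y| ^+ 2 + t ^+ 2 * `|u + w| ^+ 2 -
  `|t *: wbar + xbar - y - t *: (wbar - w)| ^+ 2.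
Proof.
move=> ->; set e := t *: wbar + xbar - _.
have -> : xbar - x = e - t *: (u + wbar).
  rewrite /e scalerDr; apply/eqP; rewrite eq_sym subr_eq opprB.
  by rewrite addrACA addrC [X in _ + X]addrC.
have -> : u + w = (u + wbar) - (wbar - w) by rewrite opprB addrACA subrr addr0.
rewrite (sqr_normBZ _ e) (sqr_normB (u + wbar)) linearBr linearZr_LR /=.
rewrite (dotC _ e) (dotC _ (u + wbar)).
by ring.
Qed.

Lemma eps_subgradient_le (h : H -> \bar R) (e : R) (x x' v : H) (a b : R) :
  eps_subdifferential dot h e x v -> h x = a%:E -> h x' = b%:E ->
  a + dot v (x' - x) - e <= b.
Proof.
by move=> /(_ x') + hx hx'; rewrite hx hx' -EFinD lee_fin addrA.
Qed.

(** A subgradient inequality tested at a point of the domain bounds h x away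
    from +oo; at xbar, which may lie outside C, this is what makes g finite. *)
Lemma eps_subgradient_fin_num (h : H -> \bar R) (e : R) (x x' v : H) :
  (-oo < h x)%E -> (h x' < +oo)%E -> eps_subdifferential dot h e x v ->
  h x \is a fin_num.
Proof.
move=> hx hx' /(_ x')/le_lt_trans/(_ hx') sum_lt; rewrite fin_real// hx /=.
by move: sum_lt; case: (h x) => [r||] //= _; exact: ltry.
Qed.

Lemma forward_backward_descent (f g : H -> \bar R) C (t e ebar c : R)
    (x u w y xbar wbar z : H) (fx fz gx gz : R) :
  C !=set0 -> closed C -> convex_set C -> C z -> 0 < t ->
  (-oo < g xbar)%E ->
  f x = fx%:E -> f z = fz%:E -> g x = gx%:E -> g z = gz%:E ->
  eps_subdifferential dot f e x u -> y = x - t *: u ->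
  eps_subdifferential dot g ebar xbar wbar -> subdifferential dot g x w ->
  `|u| <= c -> `|w| <= c ->
  `|orthogonal_projection C (y - t *: wbar) - z| ^+ 2 <=
    `|x - z| ^+ 2 - 2 * t * ((fx + gx) - (fz + gz) - e) +
    (`|t *: wbar + xbar - y| ^+ 2 + 2 * t * ebar + 4 * t ^+ 2 * c ^+ 2).
Proof.
move=> C0 Cl Cc Cz t0 gxbar Hfx Hfz Hgx Hgz fu yE gwbar gw uc wc.
have gz_fin : (g z < +oo)%E by rewrite Hgz ltry.
have := eps_subgradient_fin_num gxbar gz_fin gwbar.
move=> /fineK/esym; move: (fine _) => gb Hgb.
have h1 := eps_subgradient_le fu Hfx Hfz.
have h2 := eps_subgradient_le gwbar Hgb Hgz.
have h3 := eps_subgradient_le gw Hgx Hgb.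
have idt := backward_error_identity w wbar xbar yE.
apply: le_trans (orthogonal_projection_contract _ C0 Cl Cc Cz) _.
have -> : y - t *: wbar - z = (x - z) - t *: (u + wbar).
  rewrite yE scalerDr opprD -!addrA; congr (_ + _).
  by rewrite [RHS]addrC addrA.
rewrite sqr_normBZ.
have uw : `|u + w| ^+ 2 <= 4 * c ^+ 2.
  have : `|u + w| <= 2 * c by apply: le_trans (ler_normD _ _) _; lra.
  have c0 : 0 <= c by apply: le_trans uc.
  rewrite -(ler_pXn2r (n := 2)) ?nnegrE ?mulr_ge0// exprMn; lra.
have tuw : t ^+ 2 * `|u + w| ^+ 2 <= t ^+ 2 * (4 * c ^+ 2).
  by rewrite ler_wpM2l// sqr_ge0.
have sq0 : 0 <= `|t *: wbar + xbar - y - t *: (wbar - w)| ^+ 2.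
  by rewrite exprn_ge0.
(* The three subgradient inequalities added up: g at xbar cancels. *)
have key : - dot (x - z) (u + wbar) <=
    fz + gz - fx - gx + e + ebar + dot (wbar - w) (xbar - x).
  have -> : dot (x - z) (u + wbar) =
      - dot u (z - x) - dot wbar (z - xbar) + dot wbar (x - xbar).
    rewrite dotC linearDl -(opprB x z) linearNr /= opprK -addrA; congr (_ + _).
    by rewrite !linearBr /=; ring.
  have -> : dot (wbar - w) (xbar - x) =
      - dot wbar (x - xbar) - dot w (xbar - x).
    by rewrite -(opprB xbar x) linearNr opprK linearBl.
  by lra.
have tkey : 2 * t * - dot (x - z) (u + wbar) <=
    2 * t * (fz + gz - fx - gx + e + ebar + dot (wbar - w) (xbar - x)).
  by rewrite ler_pM2l// mulr_gt0.
by move: idt tkey tuw sq0; lra.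
Qed.

(** The residual is at most sigma |xbar - y|, and xbar - y differs from it by
    t wbar; hence (1 - sigma) |xbar - y| <= t c. *)
Lemma relative_error_le (sigma t ebar c : R) (xbar wbar y : H) :
  0 <= sigma < 1 -> 0 < t -> 0 <= ebar -> `|wbar| <= c ->
  `|t *: wbar + xbar - y| ^+ 2 + 2 * t * ebar <=
    sigma ^+ 2 * `|xbar - y| ^+ 2 ->
  `|t *: wbar + xbar - y| ^+ 2 + 2 * t * ebar <=
    t ^+ 2 * (sigma ^+ 2 / (1 - sigma) ^+ 2) * c ^+ 2.
Proof.
move=> /andP[s0 s1] t0 eb0 wc err; apply: le_trans (err) _.
have c0 : 0 <= c by apply: le_trans wc.
have teb0 : 0 <= 2 * t * ebar by rewrite !mulr_ge0// ltW.
have e_le : `|t *: wbar + xbar - y| <= sigma * `|xbar - y|.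
  rewrite -(ler_pXn2r (n := 2)) ?nnegrE ?mulr_ge0// exprMn.
  by apply: le_trans err; rewrite lerDl.
have : `|xbar - y| <= `|t *: wbar + xbar - y| + t * c.
  have -> : xbar - y = (t *: wbar + xbar - y) - t *: wbar.
    by rewrite [RHS]addrC !addrA addNr add0r.
  apply: le_trans (ler_normB _ _) _; rewrite lerD2l normrZ gtr0_norm//.
  by rewrite ler_pM2l.
move=> dist_le; have s10 : 0 < 1 - sigma by lra.
have {}dist_le : `|xbar - y| <= t * c / (1 - sigma).
  by rewrite ler_pdivlMr//; lra.
have -> : t ^+ 2 * (sigma ^+ 2 / (1 - sigma) ^+ 2) * c ^+ 2 =
    sigma ^+ 2 * (t * c / (1 - sigma)) ^+ 2.
  by rewrite !exprMn exprVn; ring.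
rewrite ler_wpM2l ?sqr_ge0// ler_pXn2r ?nnegrE//.
by rewrite divr_ge0 ?mulr_ge0// ltW.
Qed.

(** * Lower limits from the descent inequality *)

(** A nonnegative sequence cannot decrease by a fixed amount forever, so phi
    comes below s + d infinitely often, for every d > 0. *)
Lemma limn_einf_le_of_descent (phi s_ a : nat -> R) (t s : R) :
  0 < t -> (forall k, 0 <= a k) ->
  (forall k, a k.+1 <= a k - t * (phi k - s_ k)) ->
  s_ @ \oo --> s ->
  (limn_einf (fun k => (phi k)%:E) <= s%:E)%E.
Proof.
move=> t0 a0 desc s_s; rewrite limn_einf_lim.
apply: lime_le; first exact: is_cvg_einfs.
apply: nearW => n; apply/lee_addgt0Pr => d d0.
have [k nk phik] : exists2 k, (n <= k)%N & phi k <= s + d.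
  apply: contrapT => far.
  have phi_far k : (n <= k)%N -> s + d < phi k.
    by move=> nk; rewrite ltNge; apply/negP => ?; apply: far; exists k.
  have d20 : 0 < d / 2 by lra.
  have [N0 _ HN] := cvgr_le s s_s (s + d / 2) ltac:(lra).
  pose N := maxn n N0.
  (* s_ is eventually below s + d / 2, so half of the margin d remains. *)
  have drop k : (N <= k)%N -> a k.+1 <= a k - t * (d / 2).
    rewrite geq_max => /andP[nk Nk]; apply: le_trans (desc k) _.
    rewrite lerB// ler_pM2l//.
    have := phi_far _ nk; have : s_ k <= s + d / 2 := HN k Nk.
    by lra.
  have drops j : a (N + j)%N <= a N - j%:R * (t * (d / 2)).
    elim: j => [|j IH]; first by rewrite addn0 mul0r subr0.
    rewrite addnS; apply: le_trans (drop _ (leq_addr _ _)) _.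
    by rewrite -[j.+1%:R]natr1 mulrDl mul1r opprD addrA lerD2r.
  have td0 : 0 < t * (d / 2) by rewrite mulr_gt0.
  have [j _ /(_ j (leqnn j)) jlarge] := nbhs_infty_gtr (a N / (t * (d / 2))).
  have := drops j; rewrite leNgt => /negP; apply.
  by apply: lt_le_trans (a0 _); rewrite subr_lt0 -ltr_pdivrMr.
apply: le_trans (ereal_inf_lbound _) _; first by exists k.
by rewrite -EFinD lee_fin.
Qed.

(** The iterates do not depend on the comparison point z, so the bounds obtained
    for the individual points of C combine into one by the infimum. *)
Lemma limn_einf_le_inf_of_descent (F : H -> \bar R) C (x : nat -> H)
    (e_ rho : nat -> R) (t e D : R) :
  (forall z, C z -> F z \is a fin_num) -> (forall k, C (x k)) -> 0 < t ->
  e_ @ \oo --> e -> rho @ \oo --> (0 : R) ->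
  (forall z, C z -> forall k, `|x k.+1 - z| ^+ 2 <=
    `|x k - z| ^+ 2 - 2 * t * (fine (F (x k)) - fine (F z) - e_ k) +
    (rho k + 2 * t * D)) ->
  (limn_einf (fun k => F (x k)) <= ereal_inf [set F z | z in C] + (e + D)%:E)%E.
Proof.
move=> Ffin Cx t0 ee rho0 desc.
rewrite -leeBlDr//; apply: le_ereal_inf_tmp => _ [z Cz <-].
rewrite leeBlDr// -(fineK (Ffin z Cz)) -EFinD.
under eq_fun do rewrite -(fineK (Ffin _ (Cx _))).
pose s_ k := fine (F z) + (e_ k + (D + rho k / (2 * t))).
apply: (@limn_einf_le_of_descent _ s_ (fun k => `|x k - z| ^+ 2) (2 * t)).
- by rewrite mulr_gt0.
- by move=> k; rewrite exprn_ge0.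
- move=> k; apply: le_trans (desc z Cz k) _; rewrite /s_.
  have rhoE : 2 * t * (rho k / (2 * t)) = rho k.
    by rewrite mulrC divfK// gt_eqF// mulr_gt0.
  by rewrite -[in leLHS]rhoE; lra.
- have -> : fine (F z) + (e + D) = fine (F z) + (e + (D + 0 * (2 * t)^-1)).
    by rewrite mul0r addr0.
  apply: cvgD; first exact: cvg_cst.
  apply: cvgD => //; apply: cvgD; first exact: cvg_cst.
  by apply: cvgM => //; exact: cvg_cst.
Qed.

(** The common core of both methods: rho is the vanishing part of the error
    bound and E the constant part.  The absolute-error method has E = 0 and the
    relative-error method rho = 0. *)
Lemma limn_einf_le_of_error_bound (f g : H -> \bar R) C (t eps c E : R)
    (eps_ epsbar rho : nat -> R) (x y u xbar wbar : nat -> H) :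
  (forall v, -oo < g v)%E ->
  (forall z, C z -> f z \is a fin_num) ->
  (forall z, C z -> g z \is a fin_num) ->
  C !=set0 -> closed C -> convex_set C ->
  0 < t -> eps_ @ \oo --> eps -> rho @ \oo --> (0 : R) -> C (x 0%N) ->
  (forall k, exists w : H,
     [/\ subdifferential dot g (x k) w, `|w| <= c & `|u k| <= c]) ->
  (forall k, eps_subdifferential dot f (eps_ k) (x k) (u k)) ->
  (forall k, y k = x k - t *: u k) ->
  (forall k, eps_subdifferential dot g (epsbar k) (xbar k) (wbar k)) ->
  (forall k, `|t *: wbar k + xbar k - y k| ^+ 2 + 2 * t * epsbar k <=
     rho k + E) ->
  (forall k, x k.+1 = orthogonal_projection C (y k - t *: wbar k)) ->
  (limn_einf (fun k => f (x k) + g (x k)) <=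
   ereal_inf [set f z + g z | z in C] +
   (eps + (2 * t * c ^+ 2 + E / (2 * t)))%:E)%E.
Proof.
move=> gNy ffin gfin C0 Cl Cc t0 eps_cvg rho0 Cx0 bounded fu yE gwbar err xS.
have Cx k : C (x k).
  case: k => // k; rewrite xS.
  exact: (proj1 (orthogonal_projectionP _ C0 Cl Cc)).
apply: (limn_einf_le_inf_of_descent (F := fun z => (f z + g z)%E)
  (rho := rho) (t := t) _ Cx t0 eps_cvg rho0).
  by move=> z Cz; rewrite fin_numD ffin ?gfin.
move=> z Cz k; rewrite !fineD ?ffin ?gfin//.
have [w [gw wc uc]] := bounded k.
rewrite xS; apply: le_trans (forward_backward_descent C0 Cl Cc Cz t0 (gNy _)
  (esym (fineK (ffin _ (Cx k)))) (esym (fineK (ffin _ Cz)))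
  (esym (fineK (gfin _ (Cx k)))) (esym (fineK (gfin _ Cz)))
  (fu k) (yE k) (gwbar k) gw uc wc) _.
have EE : 2 * t * (E / (2 * t)) = E.
  by rewrite mulrC divfK// gt_eqF// mulr_gt0.
rewrite lerD2l mulrDr EE; have := err k; lra.
Qed.

End hilbert.

Theorem theorem1 (R : realType) (H : completeNormedModType R)
    (dot : {dot H for idfun}) (Hdot : dot_induces_norm dot)
    (f g : H -> \bar R) (C : set H)
    (f_convex : convex_efunction f) (g_convex : convex_efunction g)
    (C_neq0 : C !=set0) (C_closed : closed C) (C_convex : convex_set C)
    (dom_gf : effective_domain g `<=` effective_domain f)
    (C_int : C `<=` interior (effective_domain g))
    (sigma alpha eps c : R) (r_ alpha_ eps_ epsbar : nat -> R)
    (x y u xbar wbar : nat -> H)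
    (alpha_gt0 : 0 < alpha) (alpha_cst : forall k, alpha_ k = alpha)
    (eps_ge0 : 0 <= eps) (eps_cvg : eps_ @ \oo --> eps)
    (c_gt0 : 0 < c)
    (bounded : forall k, exists w : H, subdifferential dot g (x k) w /\
       Num.max `|wbar k| (Num.max `|w| `|u k|) <= c) :
  let sstar : \bar R := ereal_inf [set (f z + g z)%E | z in C] in
  let liminf : \bar R := limn_einf (fun k => (f (x k) + g (x k))%E) in
  let absolute :=
    absolute_error_method dot f g C r_ alpha_ eps_ x y u xbar wbar in
  let relative :=
    relative_error_method dot f g C sigma alpha_ eps_ epsbar x y u xbar wbar in
  [/\ absolute \/ relative -> sstar = -oo%E -> liminf = sstar,
      absolute -> (-oo < sstar)%E ->
        (liminf <= sstar + (eps + 2 * alpha * c ^+ 2)%R%:E)%E &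
      relative -> (-oo < sstar)%E ->
        let Csigma := sigma ^+ 2 / (1 - sigma) ^+ 2 + 4 in
        (liminf <= sstar + (eps + alpha * Csigma * c ^+ 2 / 2)%R%:E)%E ].
Proof.
move=> sstar liminf absolute relative.
have gNy : forall v, (-oo < g v)%E by case: g_convex.
have gfin z : C z -> g z \is a fin_num.
  by move=> /C_int/interior_subset gz; rewrite fin_real// gNy.
have ffin z : C z -> f z \is a fin_num.
  move=> /C_int/interior_subset/dom_gf fz; rewrite fin_real// fz andbT.
  by case: f_convex.
have wbar_le k : `|wbar k| <= c.
  by have [w [_]] := bounded k; rewrite ge_max => /andP[].
have {}bounded k : exists w : H,
    [/\ subdifferential dot g (x k) w, `|w| <= c & `|u k| <= c].
  by have [w [gw]] := bounded k; rewrite !ge_max => /and3P[_ ? ?]; exists w.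
pose Csigma := sigma ^+ 2 / (1 - sigma) ^+ 2 + 4.
have abs_le : absolute ->
    (liminf <= sstar + (eps + 2 * alpha * c ^+ 2)%R%:E)%E.
  case=> x0 r0 rsum _ _ fu yE gw err xS.
  have -> : 2 * alpha * c ^+ 2 = 2 * alpha * c ^+ 2 + 0 / (2 * alpha).
    by rewrite mul0r addr0.
  apply: (limn_einf_le_of_error_bound Hdot gNy ffin gfin C_neq0 C_closed
    C_convex alpha_gt0 eps_cvg (cvg_series_cvg_0 rsum) x0 bounded fu
    (y := y) (xbar := xbar) (epsbar := fun=> 0)) => k;
    rewrite -?(alpha_cst k)//.
  - exact: gw.
  - by rewrite mulr0 !addr0 ler_pXn2r ?nnegrE.
have rel_le : relative ->
    (liminf <= sstar + (eps + alpha * Csigma * c ^+ 2 / 2)%R%:E)%E.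
  case=> s01 x0 _ _ fu yE eb0 gw err xS.
  pose E := alpha ^+ 2 * (sigma ^+ 2 / (1 - sigma) ^+ 2) * c ^+ 2.
  have -> : alpha * Csigma * c ^+ 2 / 2 = 2 * alpha * c ^+ 2 + E / (2 * alpha).
    rewrite /E /Csigma; field; lra.
  apply: (limn_einf_le_of_error_bound Hdot gNy ffin gfin C_neq0 C_closed
    C_convex alpha_gt0 eps_cvg (rho := fun=> 0) (cvg_cst _) x0 bounded fu
    (y := y) (xbar := xbar) (epsbar := epsbar)) => k;
    rewrite -?(alpha_cst k)//.
  by rewrite add0r /E -(alpha_cst k); apply: relative_error_le => //;
    rewrite alpha_cst.
split=> [methods sNy|/abs_le//|/rel_le//].
(* Either bound exceeds sstar by a finite amount, which -oo absorbs. *)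
have [K] : exists K : R, (liminf <= sstar + K%:E)%E.
  by case: methods => [/abs_le|/rel_le] le_K; [eexists; exact: le_K..].
by rewrite sNy addNye leeNy_eq => /eqP.
Qed.
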